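(* Let $f\colon \mathbb{R}^{2\times 2}\to \mathbb{R}$ be 1-homogeneous and rank-one convex. Then $f\geq 0$ and moreover, as $f(0)=0$, $f$ is convex at zero.
   Context: $\mathbb{R}^{2\times 2}$ denotes the space of real $2\times 2$ matrices. A function $f\colon \mathbb{R}^{2\times 2}\to\mathbb{R}$ is: (i) 1-homogeneous if $f(tA)=|t|f(A)$ for all $t\in\mathbb{R}$ and all $A\in\mathbb{R}^{2\times 2}$; (ii) rank-one convex if $t\mapsto f(A+tX)$ is a convex function of $t\in\mathbb{R}$ for all $A,X\in\mathbb{R}^{2\times 2}$ with $\operatorname{rank} X=1$; (iii) convex at a matrix $X_0$ if there is a linear functional $\ell\colon\mathbb{R}^{2\times 2}\to\mathbb{R}$ with $f(A)\geq f(X_0)+\ell(A-X_0)$ for all $A\in\mathbb{R}^{2\times 2}$ (equivalently, $f(X_0)\leq\sum_i\lambda_i f(A_i)$ for every finite convex combination $\sum_i\lambda_iA_i=X_0$). *)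

(* Defs.v *)
From mathcomp Require Import all_boot all_order all_algebra.
From mathcomp Require Import all_classical all_reals.
From mathcomp Require Import convex.

Set Implicit Arguments.
Unset Strict Implicit.
Unset Printing Implicit Defensive.

Import Order.TTheory GRing.Theory Num.Theory.

Local Open Scope classical_set_scope.
Local Open Scope ring_scope.

(* Homogeneity is with [`|t|] and for every real [t], so [f] is even. *)
Definition one_homogeneous (R : realType) (f : 'M[R]_2 -> R) : Prop :=
  forall (t : R) (A : 'M[R]_2), f (t *: A) = `|t| * f A.

Definition rank_one_convex (R : realType) (f : 'M[R]_2 -> R) : Prop :=
  forall A X : 'M[R]_2, \rank X = 1%N ->
    convex_function [set: R^o] (fun t : R^o => f (A + t *: X)).

Definition convex_at (R : realType) (f : 'M[R]_2 -> R) (X0 : 'M[R]_2) : Prop :=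
  exists l : {scalar 'M[R]_2}, forall A : 'M[R]_2, f X0 + l (A - X0) <= f A.

(* Main.v *)
Require Import Defs.
From mathcomp Require Import all_boot all_order all_algebra.
From mathcomp Require Import all_classical all_reals.
From mathcomp Require Import convex interval_inference ring lra.

(** Every 2x2 matrix is a sum [X + Y] of two matrices of rank at most one. Put
    [p = f (X + Y)], [q = f (X - Y)] and [b = f Y]. As [Y] is the midpoint of
    [X + Y] and [Y - X], we get [2 b <= p + q]. As [X - Y] is the midpoint of
    [X + Y] and [X - 3 Y], and [X - 3 Y] is [-3] times the point
    [(2 Y + (Y - X)) / 3], we get [2 q <= p + (2 b + q)]. Adding the two
    inequalities yields [p >= 0]. *)

Import Order.TTheory GRing.Theory Num.Theory.

Local Open Scope ring_scope.

(** Either [B - A] has rank one and is an admissible direction, or [A = B] and both sides agree.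
    Admitting rank zero spares later case distinctions. *)
Lemma rank_one_convex_segment (R : realType) (f : 'M[R]_2 -> R)
    (f_rc : rank_one_convex f) (A B : 'M[R]_2) (t : R) :
  (\rank (B - A)%R <= 1)%N -> 0 <= t <= 1 ->
  f ((1 - t) *: A + t *: B) <= (1 - t) * f A + t * f B.
Proof.
rewrite leq_eqVlt ltnS leqn0 mxrank_eq0 subr_eq0 => /orP[/eqP rBA|/eqP ->].
  move=> /andP[t0 t1].
  have : f (A + (t * 1 + (1 - t) * 0) *: (B - A)) <=
      t * f (A + 1 *: (B - A)) + (1 - t) * f (A + 0 *: (B - A)).
    by apply: (f_rc A _ rBA (Itv01 t0 t1) 1 0); rewrite inE.
  rewrite mulr1 mulr0 addr0 scale1r scale0r addr0 subrKC [leRHS]addrC.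
  by rewrite scalerBr scalerBl scale1r addrA addrAC.
by rewrite -scalerDl -mulrDl subrK scale1r mul1r.
Qed.

Lemma ge0_sum_rank_le1 (R : realType) (f : 'M[R]_2 -> R)
    (f_hom : one_homogeneous f) (f_rc : rank_one_convex f) (X Y : 'M[R]_2) :
  (\rank X <= 1)%N -> (\rank Y <= 1)%N -> 0 <= f (X + Y).
Proof.
move=> rX rY.
have rZ (a : R) (Z : 'M[R]_2) : (\rank Z <= 1)%N -> (\rank (a *: Z)%R <= 1)%N.
  by apply: leq_trans; rewrite mxrankS ?scalemx_sub.
have fN Z : f (- Z) = f Z by rewrite -scaleN1r f_hom normrN1 mul1r.
have half01 : 0 <= (2^-1 : R) <= 1 by lra.
have third01 : 0 <= (3^-1 : R) <= 1 by lra.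
(* Each of the three segments used runs along a multiple of [X] or [Y]. *)
have := rank_one_convex_segment R f f_rc (X + Y) (Y - X) 2^-1 _ half01.
have -> : Y - X - (X + Y) = -2 *: X by apply/matrixP => i j; rewrite !mxE; ring.
have -> : (1 - 2^-1) *: (X + Y) + 2^-1 *: (Y - X) = Y.
  by apply/matrixP => i j; rewrite !mxE; field.
move=> /(_ (rZ _ _ rX)) mid_Y.
have := rank_one_convex_segment R f f_rc (X + Y) (X - 3 *: Y) 2^-1 _ half01.
have -> : X - 3 *: Y - (X + Y) = -4 *: Y.
  by apply/matrixP => i j; rewrite !mxE; ring.
(* The form [- (Y - X)] lets evenness produce [f (Y - X)], the value already present in [mid_Y]. *)
have -> : (1 - 2^-1) *: (X + Y) + 2^-1 *: (X - 3 *: Y) = - (Y - X).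
  by apply/matrixP => i j; rewrite !mxE; field.
move=> /(_ (rZ _ _ rY)); rewrite fN => mid_XBY.
have := rank_one_convex_segment R f f_rc Y (Y - X) 3^-1 _ third01.
have -> : Y - X - Y = -1 *: X by apply/matrixP => i j; rewrite !mxE; ring.
have -> : (1 - 3^-1) *: Y + 3^-1 *: (Y - X) = - 3^-1 *: (X - 3 *: Y).
  by apply/matrixP => i j; rewrite !mxE; field.
move=> /(_ (rZ _ _ rX)); rewrite f_hom normrN ger0_norm; last by lra.
move: mid_Y mid_XBY; lra.
Qed.

Theorem lemma3 (R : realType) (f : 'M[R]_2 -> R)
    (f_hom : one_homogeneous f) (f_rc : rank_one_convex f) :
  (forall A : 'M[R]_2, 0 <= f A) /\ f 0 = 0 /\ convex_at f 0.
Proof.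
have f0 : f 0 = 0 by rewrite -(scale0r 0) f_hom normr0 mul0r.
have f_ge0 A : 0 <= f A.
  (* The product keeps row [i] of [A] and clears the other. *)
  have rD i : (\rank (delta_mx i i *m A)%R <= 1)%N.
    by apply: leq_trans (mxrankM_maxl _ _) _; rewrite mxrank_delta.
  have -> : A = delta_mx 0 0 *m A + delta_mx 1 1 *m A.
    by rewrite -mulmxDl -[LHS]mul1mx mx1_sum_delta big_ord_recl big_ord1.
  exact: ge0_sum_rank_le1.
(* As [f] is nonnegative and vanishes at 0, the zero functional supports it there. *)
split=> //; split=> //; exists (\0 : 'M[R]_2 -> R) => A.
by rewrite f0 addr0.
Qed.
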